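(* Let $Y$ be a random variable, let $\psi:\mathbf R\to\mathbf R$ be a strictly convex function that is increasing on $[1,\infty)$ and decreasing on $(-\infty,1)$ with $\psi(1)=0$, and let $q\in(0,1)$. (i) Let $\{X_i^n\}$, $i=1,\dots,n$, $n=1,2,\dots$, be a double array of random variables such that for each $n$ the joint distribution of $(X_1^n,\dots,X_n^n)$ is absolutely continuous with respect to the product of its one-dimensional marginal distributions, and let $\{\xi_i^n\}$ be independent copies of $\{X_i^n\}$. Put $\phi^2_{n,n}=\phi^2_{X_1^n,\dots,X_n^n}$, $\delta_{n,n}=\delta_{X_1^n,\dots,X_n^n}$, $D^\psi_{n,n}=D^\psi_{X_1^n,\dots,X_n^n}$, $\rho^{(q)}_{n,n}=\rho^{(q)}_{X_1^n,\dots,X_n^n}$, $\mathcal H_{n,n}=\big(\tfrac12\rho^{(1/2)}_{n,n}\big)^{1/2}$. If $$\sum_{i=1}^n\xi_i^n\xrightarrow{\mathcal D}Y\quad\text{as }n\to\infty$$ and at least one of $\phi^2_{n,n}\to0$, $\delta_{n,n}\to0$, $D^\psi_{n,n}\to0$, $\rho^{(q)}_{n,n}\to0$, $\mathcal H_{n,n}\to0$ holds as $n\to\infty$, then $$\sum_{i=1}^nX_i^n\xrightarrow{\mathcal D}Y\quad\text{as }n\to\infty.$$ (ii) Let $m\ge1$, let $h:\mathbf R^m\to\mathbf R$ be an arbitrary Borel measurable function, let $\{X_t\}_{t=0}^\infty$ be a time series such that for each $t$ the joint distribution of $(X_t,\dots,X_{t+m-1})$ is absolutely continuous with respect to the product of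 its one-dimensional marginal distributions, and let $\{\xi_t\}_{t=0}^\infty$ be independent copies of $\{X_t\}$. Put $\phi^2_t=\phi^2_{X_t,\dots,X_{t+m-1}}$, $\delta_t=\delta_{X_t,\dots,X_{t+m-1}}$, $D^\psi_t=D^\psi_{X_t,\dots,X_{t+m-1}}$, $\rho^{(q)}_t=\rho^{(q)}_{X_t,\dots,X_{t+m-1}}$, $\mathcal H_t=\big(\tfrac12\rho^{(1/2)}_t\big)^{1/2}$. If $$h(\xi_t,\xi_{t+1},\dots,\xi_{t+m-1})\xrightarrow{\mathcal D}Y\quad\text{as }t\to\infty$$ and at least one of $\phi^2_t\to0$, $\delta_t\to0$, $D^\psi_t\to0$, $\rho^{(q)}_t\to0$, $\mathcal H_t\to0$ holds as $t\to\infty$, then $$h(X_t,X_{t+1},\dots,X_{t+m-1})\xrightarrow{\mathcal D}Y\quad\text{as }t\to\infty.$$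
   Context: $\xrightarrow{\mathcal D}$ denotes convergence in distribution. ''Independent copies'' of a family of random variables means a family of (within each row, in the double-array case) jointly independent random variables with the same one-dimensional distributions as the corresponding members of the original family. For random variables $Z_1,\dots,Z_k$ with joint cdf $F$ and marginal cdf's $F_1,\dots,F_k$, with $F$ absolutely continuous with respect to $dF_1\cdots dF_k$, let $G=\frac{dF}{dF_1\cdots dF_k}\ge0$ be the density (taken to be $1$ outside the support of $dF_1\cdots dF_k$). Define - multivariate Pearson coefficient: $\phi^2_{Z_1,\dots,Z_k}=\int_{\mathbf R^k}G^2\prod_{i=1}^kdF_i-1$; - relative entropy: $\delta_{Z_1,\dots,Z_k}=\int_{\mathbf R^k}\log(G)\,dF$; - multivariate divergence measure: $D^\psi_{Z_1,\dots,Z_k}=\int_{\mathbf R^k}\psi(G)\prod_{i=1}^kdF_i$; - generalized (Tsallis) entropy: $\rho^{(q)}_{Z_1,\dots,Z_k}=\frac1{1-q}\Big(1-\int_{\mathbf R^k}G^{1-q}\prod_{i=1}^kdF_i\Big)$; - Hellinger distance: $\mathcal H_{Z_1,\dots,Z_k}=\big(\tfrac12\rho^{(1/2)}_{Z_1,\dots,Z_k}\big)^{1/2}$. These quantities may take the value $+\infty$ where applicable. *)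

(* Defs.v *)
From HB Require Import structures.
From mathcomp Require Import all_boot all_order all_algebra.
From mathcomp Require Import all_classical all_reals all_analysis.
From mathcomp Require Import measurable_realfun.

Set Implicit Arguments.
Unset Strict Implicit.
Unset Printing Implicit Defensive.

Import Order.TTheory GRing.Theory Num.Theory.
Import numFieldNormedType.Exports.

Local Open Scope classical_set_scope.
Local Open Scope ring_scope.

(* The random vector (Z_0, ..., Z_(k-1)).  The sigma-algebra of k.-tuple R is
   generated by the coordinate maps, hence is the Borel one of R^k. *)
Section random_vector.
Context d (T : measurableType d) (R : realType) (P : probability T R).
Variables (k : nat) (Z : 'I_k -> {RV P >-> R}).

Definition random_vector (w : T) : k.-tuple R := [tuple Z i w | i < k].

Let measurable_random_vector : measurable_fun [set: T] random_vector.
Proof.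
apply/measurable_fun_tnthP => i.
rewrite (_ : _ \o _ = Z i); first exact: measurable_funPT.
by apply/funext => w /=; rewrite tnth_mktuple.
Qed.

HB.instance Definition _ :=
  isMeasurableFun.Build _ _ _ _ random_vector measurable_random_vector.

End random_vector.

Definition tuple_cons (R : realType) (k : nat) (p : R * k.-tuple R) :
  k.+1.-tuple R := [tuple of p.1 :: p.2].

Lemma measurable_tuple_cons (R : realType) (k : nat) :
  measurable_fun [set: R * k.-tuple R] (@tuple_cons R k).
Proof. exact: measurable_cons measurable_fst measurable_snd. Qed.

HB.instance Definition _ (R : realType) (k : nat) :=
  isMeasurableFun.Build _ _ _ _ (@tuple_cons R k) (@measurable_tuple_cons R k).

(* The product measure mu_0 x ... x mu_(k-1) on R^k, where R^0 is a point. *)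
Fixpoint tuple_product (R : realType) (k : nat) :
    ('I_k -> probability R R) -> probability (k.-tuple R) R :=
  match k with
  | 0 => fun=> \d_([tuple])
  | k'.+1 => fun mu =>
      distribution (mu ord0 \x tuple_product (fun i => mu (lift ord0 i)))%E
        (@tuple_cons R k')
  end.

Section tuple_product_box.
Local Open Scope ereal_scope.

Lemma tuple_productE (R : realType) (k : nat) (mu : 'I_k -> probability R R)
    (A : 'I_k -> set R) : (forall i, measurable (A i)) ->
  tuple_product mu [set z | forall i, A i (tnth z i)] = \prod_(i < k) mu i (A i).
Proof.
elim: k mu A => [|k IH] mu A mA /=.
  by rewrite big_ord0 diracE mem_set//; case.
rewrite big_ord_recl -IH; last by move=> i; exact: mA.
rewrite /distribution /pushforward -product_measure1E//; last first.
  rewrite (_ : [set _ | _] = \bigcap_(i in [set: 'I_k])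
      ((fun z : k.-tuple R => tnth z i) @^-1` A (lift ord0 i))).
    apply: fin_bigcap_measurable => // i _; rewrite -[X in measurable X]setTI.
    exact: measurable_tnth.
  by apply/seteqP; split => z /= zA i; [move=> _|]; exact: zA.
congr (_ _); apply/seteqP; split => -[x z] /=.
  move=> xzA; split => [|i]; first by have := xzA ord0.
  by have := xzA (lift ord0 i); rewrite tnthS.
move=> [xA zA] i; case: (unliftP ord0 i) => [j ->|->] //.
by rewrite tnthS.
Qed.

End tuple_product_box.

Section density.
Context (R : realType) (k : nat).
Local Open Scope ereal_scope.

(* The closed support: the points all of whose sup-norm balls have positive
   measure. *)
Definition msupport (mu : set (k.-tuple R) -> \bar R) : set (k.-tuple R) :=
  [set z | forall e : R, (0 < e)%R ->
     0 < mu [set w | forall i, (`|tnth w i - tnth z i| < e)%R]].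

(* dF/dM, set to 1 outside the support of M.  The derivative of the library may
   be negative on an M-null set, hence the maximum with 0. *)
Definition density (F M : probability (k.-tuple R) R) (z : k.-tuple R) : R :=
  if z \in msupport M then
    Num.max 0%R (fine (Radon_Nikodym (charge_of_finite_measure F) M z))
  else 1%R.

End density.

Section dependence_measures.
Context d (T : measurableType d) (R : realType) (P : probability T R).
Variables (k : nat) (Z : 'I_k -> {RV P >-> R}).
Local Open Scope ereal_scope.

Definition joint_law : probability (k.-tuple R) R :=
  distribution P (random_vector Z).

Definition marginal_product : probability (k.-tuple R) R :=
  tuple_product (fun i => distribution P (Z i)).

Definition joint_density : k.-tuple R -> R :=
  density joint_law marginal_product.

Definition pearson : \bar R :=
  (\int[marginal_product]_z (joint_density z ^+ 2)%:E) - 1.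

(* ln vanishes at 0, but the set where the density is 0 is null for the joint
   law. *)
Definition relative_entropy : \bar R :=
  \int[joint_law]_z (ln (joint_density z))%:E.

Definition divergence (psi : R -> R) : \bar R :=
  \int[marginal_product]_z (psi (joint_density z))%:E.

Definition tsallis (q : R) : \bar R :=
  ((1 - q)^-1)%:E *
  (1 - \int[marginal_product]_z (joint_density z `^ (1 - q))%:E).

Definition hellinger : \bar R := sqrte ((2^-1)%:E * tsallis 2^-1).

End dependence_measures.

Definition mutually_independent d (T : measurableType d) (R : realType)
    (P : probability T R) (I : eqType) (Z : I -> {RV P >-> R}) :=
  forall (s : seq I) (A : I -> set R), uniq s -> (forall i, measurable (A i)) ->
    P (\bigcap_(i in [set` s]) (Z i @^-1` A i)) =
    (\prod_(i <- s) P (Z i @^-1` A i))%E.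

Definition independent_copies d d' (T : measurableType d)
    (T' : measurableType d') (R : realType) (P : probability T R)
    (P' : probability T' R) (I : eqType)
    (Z : I -> {RV P >-> R}) (zeta : I -> {RV P' >-> R}) :=
  mutually_independent zeta /\
  forall i (A : set R), measurable A ->
    distribution P' (zeta i) A = distribution P (Z i) A.

(* Convergence of the cdf's at the continuity points of the limit; the random
   variables may live on different probability spaces. *)
Definition cvg_in_distribution (R : realType) (d : nat -> measure_display)
    (T : forall n, measurableType (d n)) (P : forall n, probability (T n) R)
    (Z : forall n, {RV P n >-> R}) d' (T' : measurableType d')
    (P' : probability T' R) (Y : {RV P' >-> R}) :=
  forall x : R, {for x, continuous (cdf Y)} ->
    cdf (Z n) x @[n --> \oo] --> cdf Y x.

Definition strictly_convex (R : realType) (psi : R -> R) :=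
  forall x y t : R, x != y -> 0 < t < 1 ->
    psi (t * x + (1 - t) * y) < t * psi x + (1 - t) * psi y.

(* Main.v *)
Require Import Defs.
From HB Require Import structures.
From mathcomp Require Import all_boot all_order all_algebra.
From mathcomp Require Import all_classical all_reals all_analysis.
From mathcomp Require Import measurable_realfun.
From mathcomp Require Import ring lra.

Set Implicit Arguments.
Unset Strict Implicit.
Unset Printing Implicit Defensive.

Import Order.TTheory GRing.Theory Num.Theory.
Import numFieldNormedType.Exports.

Local Open Scope classical_set_scope.
Local Open Scope ring_scope.

(* Let M be the product of the marginals, F the joint law and G = dF/dM.  Each of
   the five quantities is, up to a constant factor or a square root, the integral
   of f(G) against M for a function f >= 0 with f(1) = 0: (x - 1)^2,
   x ln x - x + 1, psi, or a x + (1 - a) - x^a with a = 1 - q.  Such an f is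
   bounded below by some delta > 0 on [0, 1 - e], so that
   M(A) <= F(A) + e + M(G <= 1 - e) <= F(A) + e + (1/delta) int f(G) dM,
   and the same bound for the complement of A shows that F - M tends to 0
   uniformly on measurable sets.  Since M is the law of the independent copies,
   the cdf's of the two sequences have the same limits. *)

(** * Integrands bounded away from 0 on the left of 1 *)

Section separation.
Context {R : realType}.
Implicit Types (f psi : R -> R) (a c e q s x y : R).

(** The lower bound concerns only the region below 1: two probability measures have the same mass,
    so an excess of the density over 1 is compensated by a deficit elsewhere. *)
Definition separates f :=
  [/\ measurable_fun [set: R] f, forall x, 0 <= x -> 0 <= f x &
      forall e, 0 < e ->
        exists2 delta, 0 < delta &
          forall x, 0 <= x -> x <= 1 - e -> delta <= f x].

(** The Hellinger integrand serves as a common minorant. From [2 * Num.sqrt x <= 1 + x] one gets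
    [1 - Num.sqrt x >= e / 2] on [[0, 1 - e]], whence the choice of [delta]. *)
Lemma sqrt_separates c f : 0 < c -> measurable_fun [set: R] f ->
  (forall x, 0 <= x -> c * (Num.sqrt x - 1) ^+ 2 <= f x) -> separates f.
Proof.
move=> c0 mf cf; split => // [x x0|e e0].
  by apply: le_trans (cf x x0); rewrite mulr_ge0 ?sqr_ge0 ?ltW.
exists (c * (e / 2) ^+ 2) => [|x x0 xe].
  by rewrite mulr_gt0// exprn_gt0 ?divr_gt0.
apply: le_trans (cf x x0); rewrite ler_pM2l//.
have s0 := sqrtr_ge0 x; have := sqr_sqrtr x0.
move: s0; set s := Num.sqrt x => s0 sx.
have es : e / 2 <= 1 - s by have := sqr_ge0 (1 - s); lra.
by rewrite -[leRHS]sqrrN opprB lerXn2r ?nnegrE//; lra.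
Qed.

Lemma pearson_separates : separates (fun x => (x - 1) ^+ 2).
Proof.
apply: (@sqrt_separates 1) => [//||x x0].
  by apply: measurable_funX; apply: measurable_funB.
rewrite mul1r; have s0 := sqrtr_ge0 x; have := sqr_sqrtr x0.
move: s0; set s := Num.sqrt x => s0 <-.
have -> : (s ^+ 2 - 1) ^+ 2 = (s - 1) ^+ 2 * (s + 1) ^+ 2 by ring.
by rewrite ler_peMr ?sqr_ge0//; nra.
Qed.

Lemma ln_ge x : 0 < x -> 1 - x^-1 <= ln x.
Proof.
move=> x0; have := @le_ln1Dx R (x^-1 - 1).
have -> : 1 + (x^-1 - 1) = x^-1 by ring.
by rewrite lnV ?posrE// ltrBrDl subrr invr_gt0 => /(_ x0); lra.
Qed.

(** With [s = Num.sqrt x], the bound [ln_ge] at [s] gives [x * ln x = 2 * s ^+ 2 * ln s >= 2 * s ^+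
    2 - 2 * s]; adding [1 - s ^+ 2] leaves exactly [(s - 1) ^+ 2]. *)
Lemma entropy_separates : separates (fun x => x * ln x - x + 1).
Proof.
apply: (@sqrt_separates 1) => [//||x].
  apply: measurable_funD => //; apply: measurable_funB => //.
  by apply: measurable_funM => //; exact: measurable_ln.
rewrite mul1r le_eqVlt => /predU1P[<-|x0]; first by rewrite sqrtr0; lra.
have s0 : 0 < Num.sqrt x by rewrite sqrtr_gt0.
have := sqr_sqrtr (ltW x0); move: s0; set s := Num.sqrt x => s0 <-.
rewrite lnXn//; have := ln_ge s0; rewrite -(@ler_pM2l _ (s ^+ 2)) ?exprn_gt0//.
have -> : s ^+ 2 * (1 - s^-1) = s ^+ 2 - s by field; rewrite gt_eqF.
by rewrite mulr2n; lra.
Qed.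

(** Weighted AM-GM, from Young's inequality with conjugate exponents [s^-1] and [(1 - s)^-1]. The
    second one degenerates at [s = 1], which is treated apart. *)
Lemma young_powR s x y : 0 <= x -> 0 <= y -> 0 < s <= 1 ->
  x `^ s * y `^ (1 - s) <= s * x + (1 - s) * y.
Proof.
move=> x0 y0 /andP[s0]; rewrite le_eqVlt => /predU1P[->|s1].
  by rewrite subrr powRr1// powRr0; lra.
have s10 : 0 < 1 - s by rewrite subr_gt0.
have := @conjugate_powR R (x `^ s) (y `^ (1 - s)) s^-1 (1 - s)^-1.
rewrite !powR_ge0 !invr_gt0 !invrK -!powRrM !mulfV ?gt_eqF// !powRr1//.
by move=> /(_ isT isT s0 s10); rewrite [x * s]mulrC [y * _]mulrC; apply; ring.
Qed.

(* [x `^ a] is a weighted geometric mean of [sqrt x] and [1] if [a <= 1/2], and of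
   [sqrt x] and [x] otherwise. *)
Lemma tsallis_separates a : 0 < a < 1 ->
  separates (fun x => a * x + (1 - a) - x `^ a).
Proof.
move=> /andP[a0 a1]; have [a12|a12] := leP a 2^-1.
- apply: (@sqrt_separates a) => // [|x x0].
    apply: measurable_funB; last exact: measurable_powR.
    by apply: measurable_funD => //; apply: measurable_funM.
  have := @young_powR (2 * a) (Num.sqrt x) 1 (sqrtr_ge0 x) ler01.
  rewrite powR1 -powR12_sqrt// -powRrM mulrA mulVf// mul1r mulr1 powR12_sqrt//.
  have := sqr_sqrtr x0; set s := Num.sqrt x => sx.
  have -> : 0 < 2 * a <= 1 by lra.
  by move=> /(_ isT) H; rewrite -[X in a * X + _]sx; lra.
- apply: (@sqrt_separates (1 - a)) => [||x]; first by lra.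
    apply: measurable_funB; last exact: measurable_powR.
    by apply: measurable_funD => //; apply: measurable_funM.
  rewrite le_eqVlt => /predU1P[<-|x0]; first by rewrite sqrtr0 powR0 ?gt_eqF//; lra.
  have := @young_powR (2 * (1 - a)) (Num.sqrt x) x (sqrtr_ge0 x) (ltW x0).
  rewrite -{1}(powR12_sqrt (ltW x0)) -powRrM mulrA mulVf// mul1r.
  rewrite -powRD; last by rewrite (gt_eqF x0) implybT.
  have -> : 1 - a + (1 - 2 * (1 - a)) = a by ring.
  have := sqr_sqrtr (ltW x0); set s := Num.sqrt x => sx.
  have -> : 0 < 2 * (1 - a) <= 1 by lra.
  by move=> /(_ isT); rewrite -sx; lra.
Qed.

Section strictly_convex_separation.
Variable psi : R -> R.
Hypotheses (psi_convex : strictly_convex psi)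
  (psi_nd : {in `[1, +oo[ &, {homo psi : x y / x <= y}})
  (psi_ni : {in `]-oo, 1[ &, {homo psi : x y / x <= y >-> y <= x}})
  (psi1 : psi 1 = 0).

(* Monotonicity does not compare [psi x] with [psi 1] for [x < 1]: a negative
   value would persist up to [1], contradicting convexity on [y, 2] for [y < 1]
   close to [1]. *)
Lemma strictly_convex_ge0 x : 0 <= psi x.
Proof.
have [x1|x1] := leP 1 x.
  by rewrite -psi1 psi_nd// in_itv/= ?lexx// x1.
rewrite leNgt; apply/negP => px0.
have p2 : 0 <= psi 2 by rewrite -psi1 psi_nd ?in_itv/= ?lexx//; lra.
(* The first bound puts [1 - v] to the right of [x], so [psi (1 - v) <= psi x]; the second gives
   [v * psi 2 <= - psi x]. With [t = (1 + v)^-1], the point 1 is the mean of [1 - v] and 2 with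
   weights [t] and [t * v]. *)
pose v := Num.min (1 - x) (- psi x / (psi 2 + 1)).
have v0 : 0 < v by rewrite /v lt_min subr_gt0 x1 divr_gt0 ?oppr_gt0//; lra.
have vx : v <= 1 - x by rewrite /v ge_min lexx.
have vpsi : v * psi 2 <= - psi x.
  have : v <= - psi x / (psi 2 + 1) by rewrite /v ge_min lexx orbT.
  by rewrite ler_pdivlMr; lra.
have yx : psi (1 - v) <= psi x by apply: psi_ni; rewrite ?in_itv//=; lra.
pose t := (1 + v)^-1.
have t0 : 0 < t by rewrite /t invr_gt0; lra.
have tv : t * (1 + v) = 1 by rewrite /t mulVf// gt_eqF//; lra.
have y2 : 1 - v != 2 by rewrite lt_eqF//; lra.
have t01 : 0 < t < 1 by rewrite t0/=; have := mulr_gt0 t0 v0; lra.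
have := psi_convex y2 t01.
have -> : t * (1 - v) + (1 - t) * 2 = 1 by lra.
have -> : 1 - t = t * v by lra.
rewrite psi1 -mulrA -mulrDr pmulr_rgt0//; lra.
Qed.

(** A second zero [x] would force a negative value halfway between [x] and 1. *)
Lemma strictly_convex_gt0 x : x != 1 -> 0 < psi x.
Proof.
move=> x1; rewrite lt_neqAle strictly_convex_ge0 andbT eq_sym; apply/eqP => px0.
have h : 0 < (2^-1 : R) < 1 by lra.
have := psi_convex x1 h; rewrite px0 psi1 !mulr0 addr0.
by apply/negP; rewrite -leNgt strictly_convex_ge0.
Qed.

Lemma strictly_convex_separates : separates psi.
Proof.
split => [|x _|e e0]; last 2 first.
- exact: strictly_convex_ge0.
- exists (psi (1 - e)) => [|x x0 xe]; last by apply: psi_ni; rewrite ?in_itv//=; lra.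
  by apply: strictly_convex_gt0; rewrite lt_eqF//; lra.
(* Since [psi 1 = 0], [psi] is the sum of its two monotone halves, and monotone functions are
   measurable. *)
have -> : psi = (fun x => psi (Num.min x 1)) \+ (fun x => psi (Num.max x 1)).
  by apply/funext => x /=; case: leP => _; rewrite psi1 ?addr0 ?add0r.
apply: measurable_funD.
- apply: nonincreasing_measurable => // x y xy.
  have [y1|y1] := leP 1 y; first by rewrite psi1 strictly_convex_ge0.
  have x1 := le_lt_trans xy y1; rewrite min_l; last exact: ltW.
  by apply: psi_ni; rewrite ?in_itv.
- apply: nondecreasing_measurable => // x y xy.
  by apply: psi_nd; rewrite ?in_itv/= ?andbT ?ge_max ?le_max ?lexx ?xy ?orbT.
Qed.

End strictly_convex_separation.
End separation.

(** * Boxes and the closed support of a probability on R^k *)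

Definition box (R : realType) (k : nat) (A : 'I_k -> set R) : set (k.-tuple R) :=
  [set z | forall i, A i (tnth z i)].

Lemma measurable_box (R : realType) (k : nat) (A : 'I_k -> set R) :
  (forall i, measurable (A i)) -> measurable (box A).
Proof.
move=> mA; rewrite (_ : box A =
    \bigcap_(i in [set: 'I_k]) ((fun z : k.-tuple R => tnth z i) @^-1` A i)).
  apply: fin_bigcap_measurable => // i _; rewrite -[X in measurable X]setTI.
  exact: measurable_tnth.
by apply/seteqP; split => z /= zA i; [move=> _|]; exact: zA.
Qed.

Section support.
Context {R : realType} {k : nat}.

Definition ball_box (c : 'I_k -> R) (r : R) : set (k.-tuple R) :=
  [set z | forall i, `|tnth z i - c i| < r].

Lemma measurable_ball_box c r : measurable (ball_box c r).
Proof.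
apply: (@measurable_box R k (fun i => [set x | `|x - c i| < r])) => i.
rewrite (_ : [set _ | _] = `]c i - r, c i + r[%classic)//.
by apply/seteqP; split => x /=; rewrite in_itv/= ltr_distl.
Qed.

Variable mu : probability (k.-tuple R) R.

Let rational_box (n : nat) : set (k.-tuple R) :=
  if unpickle n is Some (c, r) then
    let B := ball_box (fun i => ratr (tnth (c : k.-tuple rat) i)) (ratr r) in
    if mu B == 0%E then B else set0
  else set0.

Let measurable_rational_box n : measurable (rational_box n).
Proof.
rewrite /rational_box; case: unpickle => [[c r]|//].
by case: ifP => // _; exact: measurable_ball_box.
Qed.

(** Second countability of R^k: a point with a null box around it already lies in a null box with
    rational centre and radius. Hence the complement of the support is both measurable and null. *)
Lemma msupportC_bigcup : ~` msupport mu = \bigcup_n rational_box n.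
Proof.
apply/seteqP; split => [z /existsNP[e /not_implyP[e0 /negP]]|z [n _]].
  rewrite -leNgt => muz.
  (* With [r < e / 2], a box of radius [r] that contains [z] lies in the box of radius [e] about
     [z]. *)
  have [r] : exists r : rat, ratr r \in `]0, e / 2[.
    by apply: rat_in_itvoo; rewrite divr_gt0.
  rewrite in_itv/= => /andP[r0 re].
  have /choice[c cz] i : exists q : rat,
      ratr q \in `]tnth z i - ratr r, tnth z i + ratr r[.
    by apply: rat_in_itvoo; lra.
  pose c' : k.-tuple rat := [tuple c i | i < k].
  have {}cz i : `|tnth z i - ratr (tnth c' i)| < ratr r.
    by rewrite tnth_mktuple distrC ltr_distl; have := cz i; rewrite in_itv.
  exists (pickle (c', r)) => //; rewrite /rational_box pickleK /=.
  rewrite ifT//; rewrite eq_le measure_ge0 andbT; apply: le_trans muz.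
  apply: le_measure; rewrite ?inE.
  - exact: measurable_ball_box.
  - exact: (measurable_ball_box (tnth z)).
  move=> w /= wc i; rewrite -(subrK (ratr (tnth c' i)) (tnth w i)) -addrA.
  apply: le_lt_trans (ler_normD _ _) _; have := wc i; have := cz i.
  by rewrite [X in _ -> _ -> _ + X < _]distrC; lra.
rewrite /rational_box; case: unpickle => [[c r]|//]/=; case: eqP => // muB zB.
(* The slack of [z] inside the rational box; the neutral element 1 makes [e] positive even for
   [k = 0]. *)
pose e := \big[Num.min/1]_(i < k) (ratr r - `|tnth z i - ratr (tnth c i)|).
have e0 : 0 < e.
  by apply: lt_bigmin => // i _; rewrite subr_gt0; exact: zB.
move=> /(_ e e0); apply/negP; rewrite -leNgt -muB.
apply: le_measure; rewrite ?inE.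
- exact: (measurable_ball_box (tnth z)).
- exact: measurable_ball_box.
move=> w /= wz i.
have ei : e <= ratr r - `|tnth z i - ratr (tnth c i)| by exact: bigmin_le_cond.
rewrite -(subrK (tnth z i) (tnth w i)) -addrA.
by apply: le_lt_trans (ler_normD _ _) _; have := wz i; lra.
Qed.

Lemma measurable_msupport : measurable (msupport mu).
Proof.
rewrite -[msupport mu]setCK msupportC_bigcup.
exact/measurableC/bigcupT_measurable.
Qed.

Lemma negligible_msupportC : mu.-negligible (~` msupport mu).
Proof.
rewrite msupportC_bigcup; apply: negligible_bigcup => n.
rewrite /rational_box; case: unpickle => [[c r]|]; last exact: negligible_set0.
case: eqP => [muB0|_]; last exact: negligible_set0.
exists (ball_box (fun i => ratr (tnth c i)) (ratr r)); split => //.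
exact: measurable_ball_box.
Qed.

End support.

(** * The density, the bound on [F - M], and the integral identities *)

Section density_theory.
Context {R : realType} {k : nat} {F M : probability (k.-tuple R) R}.
Hypothesis FM : F `<< M.
Let g := density F M.

Lemma density_ge0 z : 0 <= g z.
Proof. by rewrite /g /density; case: ifP => // _; rewrite le_max lexx. Qed.

Lemma measurable_density : measurable_fun [set: k.-tuple R] g.
Proof.
apply: measurable_fun_ifT => //.
  apply: (measurable_fun_bool true).
  rewrite setTI (_ : _ @^-1` _ = msupport M); first exact: measurable_msupport.
  by apply/seteqP; split => z /=; [move/set_mem|move/mem_set].
apply: measurable_maxr => //.
apply: measurableT_comp => //.
Qed.

(** Both corrections made in [density], the value 1 off the support and the maximum with 0, alter
    the derivative only on an [M]-null set. *)
Lemma ae_density :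
  ae_eq M [set: k.-tuple R] (EFin \o g) (Radon_Nikodym_SigmaFinite.f F M).
Proof.
have := ae_eq_Radon_Nikodym_SigmaFinite FM measurableT.
have : {ae M, forall z, msupport M z} by exact: negligible_msupportC.
apply: filterS2 => z zM /(_ I) zRN _.
rewrite /= /g /density mem_set// -zRN.
have f0 := Radon_Nikodym_SigmaFinite.f_ge0 FM z.
by rewrite max_r ?fine_ge0// fineK// (Radon_Nikodym_SigmaFinite.f_fin_num FM).
Qed.

Lemma density_integral (h : k.-tuple R -> \bar R) (A : set (k.-tuple R)) :
  (forall z, 0 <= h z)%E -> measurable A -> measurable_fun A h ->
  (\int[F]_(z in A) h z = \int[M]_(z in A) (h z * (g z)%:E))%E.
Proof.
move=> h0 mA mh; rewrite -(Radon_Nikodym_SigmaFinite.change_of_variables FM)//.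
apply: ge0_ae_eq_integral => //.
- apply: emeasurable_funM => //; apply: measurable_funTS.
  exact: measurable_int (Radon_Nikodym_SigmaFinite.f_integrable FM).
- apply: emeasurable_funM => //; apply: measurable_funTS.
  by apply/measurable_EFinP; exact: measurable_density.
- by move=> z _; rewrite mule_ge0// Radon_Nikodym_SigmaFinite.f_ge0.
- by move=> z _; rewrite mule_ge0// lee_fin density_ge0.
apply: filterS ae_density => z /(_ I) /= gz _.
by rewrite -gz.
Qed.

Lemma density_mass (A : set (k.-tuple R)) : measurable A ->
  F A = (\int[M]_(z in A) (g z)%:E)%E.
Proof.
move=> mA; rewrite -[F A]mul1e -integral_cst// (density_integral _ mA)//.
by apply: eq_integral => z _; rewrite mul1e.
Qed.

Lemma integral_cst_probability c : (\int[M]_z (cst c z)%:E = c%:E)%E.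
Proof.
transitivity (c%:E * M setT)%E; first exact: (integral_cst M measurableT c%:E).
by rewrite probability_setT mule1.
Qed.

Lemma measurable_density_le c : measurable [set z | g z <= c].
Proof.
rewrite (_ : [set _ | _] = [set: _] `&` g @^-1` `]-oo, c]%classic).
  exact: measurable_density.
by rewrite setTI; apply/seteqP; split => z /=; rewrite in_itv.
Qed.

Lemma density_mass1 : (\int[M]_z (g z)%:E = 1)%E.
Proof. by rewrite -density_mass// probability_setT. Qed.

(** Where [g > 1 - e] one has [1 <= g + e]; integrating the constant [e] costs at most [e], as [M]
    has mass 1. *)
Lemma measure_le_density e (A : set (k.-tuple R)) : 0 < e -> measurable A ->
  (M A <= F A + e%:E + M [set z | (g z <= 1 - e)%R])%E.
Proof.
move=> e0 mA; set B := [set z | _].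
have mB : measurable B by exact: measurable_density_le.
have mAB : measurable (A `\` B) by exact: measurableD.
have mg := measurable_density; have g0 := density_ge0.
apply: (@le_trans _ _ (M (A `\` B) + M B)%E).
  apply: le_trans (measureU2 _ mAB mB); apply: le_measure; rewrite ?inE//.
    exact: measurableU.
  by move=> z Az; have [Bz|Bz] := pselect (B z); [right|left].
rewrite leeD2r// (density_mass mA).
apply: (@le_trans _ _ (\int[M]_(z in A `\` B) ((g z)%:E + e%:E))%E).
  rewrite -[leLHS]mul1e -integral_cst//; apply: ge0_le_integral => //.
  - by apply: emeasurable_funD => //; apply/measurable_EFinP; exact: measurable_funTS.
  - by move=> z [_ /negP]; rewrite -ltNge -EFinD lee_fin -/g; lra.
rewrite ge0_integralD//; last 3 first.
- by move=> z _; rewrite lee_fin g0.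
- by apply/measurable_EFinP; exact: measurable_funTS.
- by move=> z _; rewrite lee_fin ltW.
apply: leeD.
  apply: ge0_subset_integral => //.
  - by apply/measurable_EFinP; exact: measurable_funTS.
  - by move=> z _; rewrite lee_fin g0.
by rewrite integral_cst// -[leRHS]mule1 lee_pmul2l// ?lte_fin// probability_le1.
Qed.

(** Markov's inequality for [f] composed with [g]. *)
Lemma measure_small_density (f : R -> R) delta e :
  measurable_fun [set: R] f -> (forall x, 0 <= x -> 0 <= f x) ->
  (forall x, 0 <= x -> x <= 1 - e -> delta <= f x) -> 0 <= delta ->
  (delta%:E * M [set z | (g z <= 1 - e)%R] <= \int[M]_z (f (g z))%:E)%E.
Proof.
move=> mf f0 fd d0; set B := [set z | _].
have mg := measurable_density; have g0 := density_ge0.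
have mB : measurable B by exact: measurable_density_le.
have mfg : measurable_fun [set: k.-tuple R] (fun z => (f (g z))%:E).
  by apply/measurable_EFinP; exact: measurableT_comp.
rewrite -integral_cst//.
apply: (@le_trans _ _ (\int[M]_(z in B) (f (g z))%:E)%E).
  apply: ge0_le_integral => //.
  - exact: measurable_funTS.
  - by move=> z Bz; rewrite lee_fin fd// g0.
by apply: ge0_subset_integral => // z _; rewrite lee_fin f0// g0.
Qed.

Lemma tv_le (f : R -> R) delta e (A : set (k.-tuple R)) :
  0 < e -> 0 < delta ->
  measurable_fun [set: R] f -> (forall x, 0 <= x -> 0 <= f x) ->
  (forall x, 0 <= x -> x <= 1 - e -> delta <= f x) ->
  (\int[M]_z (f (g z))%:E <= (delta * e)%:E)%E ->
  measurable A -> `|fine (F A) - fine (M A)| <= 2 * e.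
Proof.
move=> e0 d0 mf f0 fd small.
have MB : (M [set z | (g z <= 1 - e)%R] <= e%:E)%E.
  rewrite -(@lee_pmul2l _ delta%:E)// ?lte_fin// -EFinM.
  by apply: le_trans small; apply: measure_small_density => //; exact: ltW.
(* One [e] is lost in [measure_le_density], the other comes from [MB]. *)
have half B : measurable B -> fine (M B) <= fine (F B) + 2 * e.
  move=> mB; rewrite -lee_fin EFinD !fineK ?fin_num_measure//.
  apply: le_trans (measure_le_density e0 mB) _.
  by rewrite mulr2n mulrDl !mul1r EFinD addeA leeD2l.
move=> mA; have := half _ mA; have := half _ (measurableC mA).
rewrite !probability_setC// !fineB ?fin_num_measure//= ler_norml.
by move=> *; apply/andP; split; lra.
Qed.

Lemma integralD_EFin (u v : k.-tuple R -> R) :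
  measurable_fun [set: k.-tuple R] u -> measurable_fun [set: k.-tuple R] v ->
  (forall z, 0 <= u z) -> (forall z, 0 <= v z) ->
  (\int[M]_z (u z + v z)%:E = \int[M]_z (u z)%:E + \int[M]_z (v z)%:E)%E.
Proof.
move=> mu mv u0 v0; under eq_integral do rewrite EFinD.
by rewrite ge0_integralD//;
  solve [by apply/measurable_EFinP | by move=> z _; rewrite lee_fin].
Qed.

(** Finite terms cancel even if [x] or [y] is infinite. Identities with subtractions can thus be
    rearranged into sums of nonnegative integrands, with no integrability assumption. *)
Lemma adde_cancel (x y : \bar R) (b c : R) :
  (x + b%:E = y + c%:E -> x = y + (c - b)%:E)%E.
Proof.
by move: x y => [x| |] [y| |]//= []; move=> xy; congr EFin; lra.
Qed.

(** Integrate [(g - 1) ^+ 2 + 2 * g = g ^+ 2 + 1], whose terms are all nonnegative, using that [g]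
    has integral 1. *)
Lemma integral_density_sqr :
  (\int[M]_z (g z ^+ 2)%:E - 1 = \int[M]_z ((g z - 1) ^+ 2)%:E)%E.
Proof.
have mg := measurable_density; have g0 := density_ge0.
rewrite [RHS](@adde_cancel _ (\int[M]_z (g z ^+ 2)%:E) 2 1).
  by rewrite (_ : 1 - 2 = -1)//; ring.
have -> : 2%:E = (\int[M]_z (2 * g z)%:E)%E.
  under eq_integral do rewrite EFinM.
  rewrite ge0_integralZl ?density_mass1 ?mule1//.
  - exact/measurable_EFinP.
  - by move=> z _; rewrite lee_fin g0.
rewrite -integralD_EFin//.
- rewrite -[1%:E in RHS](_ : \int[M]_z (cst 1 z)%:E = _)%E; last first.
    exact: integral_cst_probability.
  rewrite -integralD_EFin//; last by move=> z; rewrite sqr_ge0.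
    by apply: eq_integral => z _; congr EFin; rewrite /cst; ring.
  exact: measurable_funX.
- by apply: measurable_funX; exact: measurable_funB.
- exact: measurable_funM.
- by move=> z; rewrite sqr_ge0.
- by move=> z; rewrite mulr_ge0// g0.
Qed.

(** The left integrand and the power of [g] are nonnegative with sum [a * g + (1 - a)], of integral
    1. Both integrals are therefore finite and may be subtracted. *)
Lemma integral_density_powR a : 0 < a < 1 ->
  (\int[M]_z (a * g z + (1 - a) - g z `^ a)%:E =
   1 - \int[M]_z (g z `^ a)%:E)%E.
Proof.
move=> a01; have /andP[a0 a1] := a01.
have mg := measurable_density; have g0 := density_ge0.
have [mf f0 _] := tsallis_separates a01.
have mp : measurable_fun [set: k.-tuple R] (fun z => g z `^ a).
  exact: measurableT_comp (measurable_powR _) mg.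
have := @integralD_EFin (fun z => a * g z + (1 - a) - g z `^ a)
  (fun z => g z `^ a).
rewrite (_ : (\int[M]_z _)%E = 1%E); last first.
  transitivity (\int[M]_z (a * g z + cst (1 - a) z)%:E)%E.
    by apply: eq_integral => z _; congr EFin; rewrite /cst; ring.
  rewrite integralD_EFin//; last 3 first.
  - exact: measurable_funM.
  - by move=> z; rewrite mulr_ge0// ltW.
  - by move=> z; rewrite /cst subr_ge0 ltW.
  under eq_integral do rewrite EFinM.
  rewrite ge0_integralZl ?lee_fin ?ltW//; last 2 first.
  - exact/measurable_EFinP.
  - by move=> z _; rewrite lee_fin g0.
  rewrite density_mass1 integral_cst_probability mule1 -EFinD.
  by congr EFin; ring.
have pp0 : (0 <= \int[M]_z (g z `^ a)%:E)%E.
  by apply: integral_ge0 => z _; rewrite lee_fin powR_ge0.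
have L0 : (0 <= \int[M]_z (a * g z + (1 - a) - g z `^ a)%:E)%E.
  by apply: integral_ge0 => z _; rewrite lee_fin f0.
move=> /(_ (measurableT_comp mf mg) mp (fun z => f0 _ (g0 z)) (fun z => powR_ge0 _ _)).
move: L0 pp0.
case: (\int[M]_z _)%E => [x| |]//; case: (\int[M]_z _)%E => [y| |]// _ _.
by move=> [->]; rewrite -EFinB; congr EFin; ring.
Qed.

(** Changing measure multiplies the integrand by [g]. The positive part [p] of [g * ln g] may have
    infinite integral, but its negative part [n] is bounded by 1, so the difference never takes the
    form [oo - oo]. *)
Lemma integral_density_ln :
  (\int[F]_z (ln (g z))%:E = \int[M]_z (g z * ln (g z) - g z + 1)%:E)%E.
Proof.
have mg := measurable_density; have g0 := density_ge0.
have [mf f0 _] := @entropy_separates R.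
have ml : measurable_fun [set: k.-tuple R] (fun z => ln (g z)).
  exact: measurableT_comp (@measurable_ln R) mg.
pose p z := Num.max (ln (g z)) 0 * g z.
pose n z := Num.max (- ln (g z)) 0 * g z.
have mp : measurable_fun [set: k.-tuple R] p.
  by apply: measurable_funM => //; exact: measurable_maxr.
have mn : measurable_fun [set: k.-tuple R] n.
  by apply: measurable_funM => //; apply: measurable_maxr => //; exact: measurable_funN.
have p0 z : 0 <= p z by rewrite mulr_ge0 ?g0// le_max lexx orbT.
have n0 z : 0 <= n z by rewrite mulr_ge0 ?g0// le_max lexx orbT.
(* Nonnegativity of [x * ln x - x + 1] at [x = g z] gives [- (x * ln x) <= 1 - x <= 1]. *)
have n1 z : n z <= 1.
  have := f0 _ (g0 z); have := g0 z.
  by rewrite /n; case: (leP (- ln (g z)) 0); lra.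
rewrite integralE !density_integral//; last first.
- by apply: measurable_funepos; exact/measurable_EFinP.
- by apply: measurable_funeneg; exact/measurable_EFinP.
have -> : (\int[M]_z ((fun z => (ln (g z))%:E)^\+ z * (g z)%:E) =
    \int[M]_z (p z)%:E)%E.
  by apply: eq_integral => z _; rewrite funeposE -EFin_max -EFinM.
have -> : (\int[M]_z ((fun z => (ln (g z))%:E)^\- z * (g z)%:E) =
    \int[M]_z (n z)%:E)%E.
  by apply: eq_integral => z _; rewrite funenegE -EFinN -EFin_max -EFinM.
have Nfin : (\int[M]_z (n z)%:E \is a fin_num)%E.
  rewrite ge0_fin_numE; last by apply: integral_ge0 => z _; rewrite lee_fin.
  apply: (@le_lt_trans _ _ (\int[M]_z (cst 1%R z)%:E)%E); last first.
    by rewrite integral_cst_probability ltry.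
  apply: ge0_le_integral => //.
  - by move=> z _; rewrite lee_fin.
  - exact/measurable_EFinP.
  - exact/measurable_EFinP.
  - by move=> z _; rewrite lee_fin.
(* The identity without subtraction of integrals: [(g * ln g - g + 1) + (g + n) = p + 1]. *)
rewrite [RHS](@adde_cancel _ (\int[M]_z (p z)%:E)
  (1 + fine (\int[M]_z (n z)%:E)) 1).
  by rewrite opprD addrA subrr add0r EFinN fineK.
rewrite EFinD fineK// -{1}density_mass1 -integralD_EFin//.
have mL : measurable_fun [set: k.-tuple R] (fun z => g z * ln (g z) - g z + 1).
  exact: measurableT_comp mf mg.
rewrite -integralD_EFin//.
- rewrite -[1%:E in RHS](_ : \int[M]_z (cst 1 z)%:E = _)%E; last first.
    exact: integral_cst_probability.
  rewrite -integralD_EFin//; apply: eq_integral => z _; congr EFin.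
  have lnE : Num.max (ln (g z)) 0 = ln (g z) + Num.max (- ln (g z)) 0.
    by case: (leP (ln (g z)) 0); case: (leP (- ln (g z)) 0); lra.
  by rewrite /cst /p /n lnE; ring.
- exact: measurable_funD.
- by move=> z; exact: f0.
- by move=> z; rewrite addr_ge0.
Qed.

End density_theory.

(** * Laws determined by boxes, and the law of independent copies *)

Section tuple_law.
Context {R : realType} {k : nat}.

(** Boxes are stable under intersection and generate the sigma-algebra of tuples. *)
Lemma tuple_measure_unique (mu nu : probability (k.-tuple R) R) :
  (forall A, (forall i, measurable (A i)) -> mu (box A) = nu (box A)) ->
  forall B, measurable B -> mu B = nu B.
Proof.
move=> munu.
pose G := [set B | exists2 A : 'I_k -> set R,
  (forall i, measurable (A i)) & B = box A].
apply: (measure_unique G (fun=> setT)).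
- apply/seteqP; split; last first.
    apply: smallest_sub; first exact: sigma_algebra_measurable.
    by move=> _ [A mA ->]; exact: measurable_box.
  apply: smallest_sub; first exact: smallest_sigma_algebra.
  elim/big_ind : _ => [//|U V|i _ _ [C mC <-]]; first by rewrite subUset.
  (* A coordinate cylinder is the box whose other sides are the whole line. *)
  apply: sub_sigma_algebra; exists (fun j => if j == i then C else setT).
    by move=> j; case: ifP.
  rewrite setTI; apply/seteqP; split => z /=; last by move=> /(_ i); rewrite eqxx.
  by move=> zC j; case: eqP => [->|].
- move=> _ _ [A mA ->] [A' mA' ->]; exists (fun i => A i `&` A' i).
    by move=> i; exact: measurableI.
  apply/seteqP; split => z /=; first by move=> [zA zA'] i; split.
  by move=> zA; split => i; have [] := zA i.
- move=> _; exists (fun=> setT) => //.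
  by apply/seteqP; split => z.
- by apply/seteqP; split => // z _; exists 0%N.
- by move=> _ [A mA ->]; exact: munu.
- by move=> _; apply: le_lt_trans (probability_le1 mu measurableT) (ltry _).
Qed.

End tuple_law.

Section independent_law.
Context {R : realType} {d d'} {T : measurableType d} {T' : measurableType d'}.
Context {P : probability T R} {P' : probability T' R}.

Lemma mutually_independent_comp (I : eqType) (k : nat) (f : 'I_k -> I)
    (Z : I -> {RV P >-> R}) : injective f ->
  mutually_independent Z -> mutually_independent (fun i => Z (f i)).
Proof.
move=> f_inj indZ s A us mA.
(* The family [A] carried along [f], with the whole line off the image; injectivity of [f] makes it
   well defined. *)
pose A' j := if [pick i | f i == j] is Some i then A i else setT.
have A'f i : A' (f i) = A i.
  rewrite /A'; case: pickP => [j /eqP/f_inj -> //|/(_ i)].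
  by rewrite eqxx.
have := indZ [seq f i | i <- s] A'.
rewrite map_inj_uniq// big_map => /(_ us) H.
have mA' j : measurable (A' j) by rewrite /A'; case: pickP => [i _|_].
have {H} := H mA'; under [X in _ = X -> _]eq_bigr do rewrite A'f.
move=> <-; congr (P _); apply/seteqP; split => w /= wA.
- by move=> _ /= /mapP[i si ->]; rewrite A'f; exact: wA.
- by move=> i /= si; rewrite -A'f; apply: wA; exact: map_f.
Qed.

(** On a box, independence over the full list of indices yields the product of the marginal
    probabilities, which is also the value of the product measure. *)
Lemma independent_copies_law (k : nat) (X : 'I_k -> {RV P >-> R})
    (xi : 'I_k -> {RV P' >-> R}) (B : set (k.-tuple R)) :
  independent_copies X xi -> measurable B ->
  joint_law xi B = marginal_product X B.
Proof.
move=> [ind same]; apply: tuple_measure_unique => A mA.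
rewrite [RHS]tuple_productE//.
transitivity (\prod_(i < k) distribution P' (xi i) (A i))%E; last first.
  by apply: eq_bigr => i _; exact: same.
have := ind (index_enum 'I_k) A (index_enum_uniq _) mA => <-.
rewrite /joint_law /distribution /pushforward; congr (P' _).
apply/seteqP; split => w /=.
  by move=> wA i _; have := wA i; rewrite tnth_mktuple.
by move=> wA i; rewrite tnth_mktuple; apply: wA; rewrite /= mem_index_enum.
Qed.

End independent_law.

(** * Vanishing dependence measures and uniform closeness of the laws *)

Section total_variation.
Context {R : realType}.

(** Convergence in total variation. The dimension varies with [n], so that rows of length [n] and
    blocks of fixed length [m] are both covered. *)
Definition tv_cvg0 (k : nat -> nat) (F M : forall n, probability ((k n).-tuple R) R) :=
  forall e : R, 0 < e -> \forall n \near \oo, forall A : set ((k n).-tuple R),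
    measurable A -> `|fine (F n A) - fine (M n A)| <= e.

(** The [delta] given by [separates] depends on [e] and [f] alone, so the estimate is uniform in the
    dimension. *)
Lemma separates_tv_cvg0 (k : nat -> nat)
    (F M : forall n, probability ((k n).-tuple R) R) (f : R -> R) :
  separates f -> (forall n, F n `<< M n) ->
  (\int[M n]_z (f (density (F n) (M n) z))%:E)%E @[n --> \oo] --> 0%E ->
  tv_cvg0 F M.
Proof.
move=> [mf f0 fsep] FM cvg0 e e0.
have e20 : 0 < e / 2 by rewrite divr_gt0.
have [delta delta0 fd] := fsep _ e20.
have : \forall n \near \oo,
    (\int[M n]_z (f (density (F n) (M n) z))%:E < (delta * (e / 2))%:E)%E.
  have /fine_cvgP[cvg_fin /cvgr_lt cvg_lt] := cvg0.
  have := cvg_lt _ (mulr_gt0 delta0 e20); move: cvg_fin.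
  by apply: filterS2 => n /= nfin; rewrite -lte_fin fineK.
apply: filterS => n /ltW small A mA.
have -> : e = 2 * (e / 2) by rewrite mulrCA mulfV ?mulr1.
exact: (tv_le (FM n) _ _ _ _ _ small).
Qed.

Section dependence.
Variables (k : nat -> nat) (d : nat -> measure_display).
Variables (T : forall n, measurableType (d n)) (P : forall n, probability (T n) R).
Variable X : forall n, 'I_(k n) -> {RV P n >-> R}.
Arguments X : clear implicits.
Hypothesis ac : forall n, joint_law (X n) `<< marginal_product (X n).

Let tv := tv_cvg0 (fun n => joint_law (X n)) (fun n => marginal_product (X n)).

Lemma pearson_tv_cvg0 : pearson (X n) @[n --> \oo] --> 0%E -> tv.
Proof.
move=> cvg0; apply: (separates_tv_cvg0 pearson_separates ac).
by under eq_fun do rewrite -integral_density_sqr//.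
Qed.

Lemma relative_entropy_tv_cvg0 : relative_entropy (X n) @[n --> \oo] --> 0%E -> tv.
Proof.
move=> cvg0; apply: (separates_tv_cvg0 entropy_separates ac).
by under eq_fun do rewrite -integral_density_ln//.
Qed.

Lemma divergence_tv_cvg0 (psi : R -> R) : separates psi ->
  divergence (X n) psi @[n --> \oo] --> 0%E -> tv.
Proof. by move=> psi_sep; exact: separates_tv_cvg0. Qed.

Lemma tsallis_integral q n : 0 < q < 1 ->
  tsallis (X n) q = ((1 - q)^-1%:E * \int[marginal_product (X n)]_z
    ((1 - q) * joint_density (X n) z + (1 - (1 - q)) -
       joint_density (X n) z `^ (1 - q))%:E)%E.
Proof. by move=> q01; rewrite integral_density_powR//; lra. Qed.

Lemma tsallis_tv_cvg0 q : 0 < q < 1 -> tsallis (X n) q @[n --> \oo] --> 0%E -> tv.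
Proof.
move=> q01 cvg0; have p01 : 0 < 1 - q < 1 by lra.
apply: (separates_tv_cvg0 (tsallis_separates p01) ac).
rewrite -[0%E](mule0 (1 - q)%:E).
rewrite [X in X @ _ --> _](_ : _ = fun n => (1 - q)%:E * tsallis (X n) q)%E.
  exact: cvgeZl.
apply/funext => n; rewrite tsallis_integral// muleA -EFinM mulfV ?mul1e//; lra.
Qed.

Lemma tsallis_ge0 q n : 0 < q < 1 -> (0 <= tsallis (X n) q)%E.
Proof.
move=> q01; have p01 : 0 < 1 - q < 1 by lra.
rewrite tsallis_integral// mule_ge0//; first by rewrite lee_fin invr_ge0; lra.
have [_ f0 _] := tsallis_separates p01.
by apply: integral_ge0 => z _; rewrite lee_fin f0// density_ge0.
Qed.

(** By [tsallis_ge0] the square root is genuine, so squaring recovers the Tsallis entropy with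
    [q = 2^-1]. *)
Lemma hellinger_tv_cvg0 : hellinger (X n) @[n --> \oo] --> 0%E -> tv.
Proof.
move=> cvg0; have h01 : 0 < (2^-1 : R) < 1 by lra.
apply: (tsallis_tv_cvg0 h01).
have sq n : (2%:E * (hellinger (X n) * hellinger (X n)) = tsallis (X n) 2^-1)%E.
  rewrite -expe2 sqr_sqrte; last by rewrite mule_ge0 ?lee_fin// tsallis_ge0.
  by rewrite muleA -EFinM mulfV ?mul1e.
under eq_fun do rewrite -sq.
rewrite -[0%E](mule0 2%:E); apply: cvgeZl => //.
by rewrite -[X in _ --> X](mule0 0%E); exact: cvgeM.
Qed.

End dependence.

(** * Transfer of convergence in distribution *)

Section transfer.
Variables (k : nat -> nat) (h : forall n, {mfun (k n).-tuple R >-> R}).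
Variables (d d' : nat -> measure_display).
Variables (T : forall n, measurableType (d n)) (P : forall n, probability (T n) R).
Variables (T' : forall n, measurableType (d' n)) (P' : forall n, probability (T' n) R).
Variables (X : forall n, 'I_(k n) -> {RV P n >-> R}).
Variables (xi : forall n, 'I_(k n) -> {RV P' n >-> R}).
Arguments X : clear implicits.
Arguments xi : clear implicits.
Variables (Z : forall n, {RV P n >-> R}) (zeta : forall n, {RV P' n >-> R}).
Hypothesis copies : forall n, independent_copies (X n) (xi n).
Hypothesis ZE : forall n w, Z n w = h n (random_vector (X n) w).
Hypothesis zetaE : forall n w, zeta n w = h n (random_vector (xi n) w).
Hypothesis tv : tv_cvg0 (fun n => joint_law (X n)) (fun n => marginal_product (X n)).

(** At [x] the two cdf's are the joint law and the product law of one set [A n], the preimage of a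
    half-line under [h n]. This set changes with [n], which is why closeness uniform over measurable
    sets is required. *)
Lemma cvg_in_distribution_transfer dY (TY : measurableType dY)
    (PY : probability TY R) (Y : {RV PY >-> R}) :
  cvg_in_distribution zeta Y -> cvg_in_distribution Z Y.
Proof.
move=> cvgY x xY; have {cvgY} := cvgY x xY.
pose A n := h n @^-1` `]-oo, x]%classic.
have mA n : measurable (A n) by rewrite -[A n]setTI; exact: measurable_funP.
have -> : (fun n => cdf (Z n) x) = (fun n => joint_law (X n) (A n)).
  apply/funext => n; rewrite /cdf /joint_law /distribution /pushforward.
  by congr (P n _); apply/seteqP; split => w /=; rewrite ZE.
have -> : (fun n => cdf (zeta n) x) = (fun n => marginal_product (X n) (A n)).
  apply/funext => n; rewrite -(independent_copies_law (copies n)); last exact: mA.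
  rewrite /cdf /joint_law /distribution /pushforward.
  by congr (P' n _); apply/seteqP; split => w /=; rewrite zetaE.
have Yfin : cdf Y x = (fine (cdf Y x))%:E by rewrite fineK// fin_num_measure.
rewrite Yfin => /fine_cvgP[_ cvgM]; apply/fine_cvgP; split.
  by apply: nearW => n; apply: fin_num_measure; exact: mA.
apply/cvgrPdist_le => e e0; have e20 : 0 < e / 2 by rewrite divr_gt0.
move/cvgrPdist_le : cvgM => /(_ _ e20); have := tv e20.
apply: filterS2 => n /(_ _ (mA n)) FM Mx /=.
move: FM Mx; rewrite /= !ler_norml => /andP[? ?] /andP[? ?]; apply/andP; split; lra.
Qed.

End transfer.
End total_variation.

Section dependence_cases.
Context {R : realType} (psi : R -> R) (q : R).
Hypotheses (psi_sep : separates psi) (q01 : 0 < q < 1).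
Variables (k : nat -> nat) (d : nat -> measure_display).
Variables (T : forall n, measurableType (d n)) (P : forall n, probability (T n) R).
Variable X : forall n, 'I_(k n) -> {RV P n >-> R}.
Arguments X : clear implicits.
Hypothesis ac : forall n, joint_law (X n) `<< marginal_product (X n).

Lemma dependence_tv_cvg0 :
    [\/ pearson (X n) @[n --> \oo] --> 0%E,
        relative_entropy (X n) @[n --> \oo] --> 0%E,
        divergence (X n) psi @[n --> \oo] --> 0%E |
        tsallis (X n) q @[n --> \oo] --> 0%E \/
        hellinger (X n) @[n --> \oo] --> 0%E] ->
  tv_cvg0 (fun n => joint_law (X n)) (fun n => marginal_product (X n)).
Proof.
move=> [||| []].
- exact: pearson_tv_cvg0.
- exact: relative_entropy_tv_cvg0.
- exact: divergence_tv_cvg0.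
- exact: tsallis_tv_cvg0.
- exact: hellinger_tv_cvg0.
Qed.

End dependence_cases.

(** Presents a row sum as a measurable function of the random vector, so that the double-array case
    is an instance of the transfer lemma. *)
Definition tuple_sum (R : realType) (n : nat) : n.-tuple R -> R :=
  fun z => \sum_(i < n) tnth z i.

Lemma measurable_tuple_sum (R : realType) (n : nat) :
  measurable_fun [set: n.-tuple R] (@tuple_sum R n).
Proof. by apply: measurable_sum => i; exact: measurable_tnth. Qed.

HB.instance Definition _ (R : realType) (n : nat) :=
  isMeasurableFun.Build _ _ _ _ (@tuple_sum R n) (@measurable_tuple_sum R n).

Lemma sum_random_vector d (T : measurableType d) (R : realType)
    (P : probability T R) (n : nat) (X : 'I_n -> {RV P >-> R}) (w : T) :
  (\sum_(i < n) X i : {RV P >-> R}) w = tuple_sum (random_vector X w).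
Proof.
by rewrite mfun_sum; apply: eq_bigr => i _; rewrite tnth_mktuple.
Qed.

Theorem theorem7p2 (R : realType)
    (dY : measure_display) (TY : measurableType dY) (PY : probability TY R)
    (Y : {RV PY >-> R})
    (psi : R -> R) (q : R) :
  strictly_convex psi ->
  {in `[1, +oo[ &, {homo psi : x y / x <= y}} ->
  {in `]-oo, 1[ &, {homo psi : x y / x <= y >-> y <= x}} ->
  psi 1 = 0 ->
  0 < q < 1 ->
  (forall (d d' : nat -> measure_display)
      (T : forall n, measurableType (d n)) (P : forall n, probability (T n) R)
      (T' : forall n, measurableType (d' n)) (P' : forall n, probability (T' n) R)
      (X : forall n, 'I_n -> {RV P n >-> R})
      (xi : forall n, 'I_n -> {RV P' n >-> R}),
    (forall n, joint_law (X n) `<< marginal_product (X n)) ->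
    (forall n, independent_copies (X n) (xi n)) ->
    cvg_in_distribution (fun n => (\sum_(i < n) xi n i : {RV P' n >-> R})) Y ->
    [\/ pearson (X n) @[n --> \oo] --> 0%E,
        relative_entropy (X n) @[n --> \oo] --> 0%E,
        divergence (X n) psi @[n --> \oo] --> 0%E |
        tsallis (X n) q @[n --> \oo] --> 0%E \/
        hellinger (X n) @[n --> \oo] --> 0%E] ->
    cvg_in_distribution (fun n => (\sum_(i < n) X n i : {RV P n >-> R})) Y)
  /\
  (forall (m : nat) (h : {mfun m.-tuple R >-> R})
      (d d' : measure_display)
      (T : measurableType d) (P : probability T R)
      (T' : measurableType d') (P' : probability T' R)
      (X : nat -> {RV P >-> R}) (xi : nat -> {RV P' >-> R}),
    let block := fun (t : nat) (i : 'I_m) => X (t + i)%N in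
    let block' := fun (t : nat) (i : 'I_m) => xi (t + i)%N in
    (1 <= m)%N ->
    (forall t, joint_law (block t) `<< marginal_product (block t)) ->
    independent_copies X xi ->
    cvg_in_distribution
      (fun t => (h \o random_vector (block' t) : {RV P' >-> R})) Y ->
    [\/ pearson (block t) @[t --> \oo] --> 0%E,
        relative_entropy (block t) @[t --> \oo] --> 0%E,
        divergence (block t) psi @[t --> \oo] --> 0%E |
        tsallis (block t) q @[t --> \oo] --> 0%E \/
        hellinger (block t) @[t --> \oo] --> 0%E] ->
    cvg_in_distribution
      (fun t => (h \o random_vector (block t) : {RV P >-> R})) Y).
Proof.
move=> psi_convex psi_nd psi_ni psi1 q01.
have psi_sep := strictly_convex_separates psi_convex psi_nd psi_ni psi1.
split.
- move=> d d' T P T' P' X xi ac copies cvgY dep.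
  apply: (cvg_in_distribution_transfer (h := fun n => @tuple_sum R n) copies _ _ _ cvgY).
  + by move=> n w; exact: sum_random_vector.
  + by move=> n w; exact: sum_random_vector.
  + exact: (dependence_tv_cvg0 psi_sep q01 ac dep).
- move=> m h d d' T P T' P' X xi block block' _ ac [ind same] cvgY dep.
  (* Independence passes to each block because the shift by [t] is injective on indices. *)
  have copies t : independent_copies (block t) (block' t).
    split; last by move=> i A mA; exact: same.
    apply: (mutually_independent_comp (f := fun i : 'I_m => (t + i)%N)) ind.
    by move=> i j /addnI /val_inj.
  apply: (cvg_in_distribution_transfer (h := fun=> h) copies _ _ _ cvgY) => //.
  exact: (dependence_tv_cvg0 psi_sep q01 ac dep).
Qed.
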